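(* Let $\theta_1,\theta_2$ be real numbers, at least one of which is irrational, and let $y_0$ be any real number. Consider the stochastic process $\mathcal{P}(\theta_1,\theta_2,y_0)$. Then with probability one, the realization $\omega=(y_1,y_2,y_3,\dots)$ is uniformly distributed modulo one; equivalently, with probability one, $$\lim_{N\to\infty} D(\{y_1,\dots,y_N\}) = 0.$$
   Context: Given real $\theta_1,\theta_2$ and an initial value $y_0$, the stochastic process $\mathcal{P}(\theta_1,\theta_2,y_0)$ has realizations $\omega=(y_1,y_2,y_3,\dots)$ generated by $y_{n+1}=y_n+\theta_1$ with probability $\frac12$ and $y_{n+1}=y_n+\theta_2$ with probability $\frac12$, for $n\ge 0$, the choices at different steps being independent. For a real number $y$, $\{\{y\}\} := y - \lfloor y \rfloor$. The discrepancy of a finite list $\mathcal{Y}=\{y_1,\dots,y_N\}$ is $D(\mathcal{Y}) := \sup_{0\le \alpha\le\beta\le 1}| \frac{1}{N}\#\{i : \alpha \le \{\{y_i\}\} \le \beta\} - (\beta-\alpha)|$. A sequence is uniformly distributed modulo one if for all $0\le\alpha\le\beta\le1$ the proportion of $i\le N$ with $\{\{y_i\}\}\in[\alpha,\beta]$ tends to $\beta-\alpha$ as $N\to\infty$. *)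

(* Defs.v *)
From HB Require Import structures.
From mathcomp Require Import all_boot all_order all_algebra.
From mathcomp Require Import all_classical all_reals all_analysis.

Set Implicit Arguments.
Unset Strict Implicit.
Unset Printing Implicit Defensive.

Import Order.TTheory GRing.Theory Num.Theory.
Import numFieldNormedType.Exports.

Local Open Scope classical_set_scope.
Local Open Scope ring_scope.

Definition fracpart (R : realType) (x : R) : R := x - (Num.floor x)%:~R.

Definition proportion (R : realType) (s : seq R) (a b : R) : R :=
  (count (fun x => a <= fracpart x <= b) s)%:R / (size s)%:R.

(* For a nonempty list this is a genuine supremum: the set is nonempty and
   bounded by 1. The value on the empty list is a junk value. *)
Definition discrepancy (R : realType) (s : seq R) : R :=
  sup [set r | exists a b : R, [/\ 0 <= a, a <= b, b <= 1 &
                                   r = `|proportion s a b - (b - a)|]].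

(* [mkseq u N] lists the first [N] terms [u 0, ..., u N.-1]. *)
Definition uniformly_distributed_mod1 (R : realType) (u : nat -> R) : Prop :=
  forall a b : R, 0 <= a -> a <= b -> b <= 1 ->
    (fun N : nat => proportion (mkseq u N) a b) @ \oo --> b - a.

Definition mutually_independent (d : measure_display) (T : measurableType d)
    (R : realType) (P : probability T R)
    (d' : measure_display) (T' : measurableType d')
    (X : nat -> {RV P >-> T'}) : Prop :=
  forall (J : seq nat) (A : nat -> set T'), uniq J ->
    (forall n, measurable (A n)) ->
    (P (\bigcap_(n in [set` J]) X n @^-1` A n) =
       \prod_(n <- J) P (X n @^-1` A n))%E.

(* The choice between [theta1] and [theta2] at each step is carried by a fair
   coin [c n], rather than read off the increment, so that [theta1 = theta2]
   is covered. *)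
Definition is_process (d : measure_display) (T : measurableType d)
    (R : realType) (P : probability T R) (theta1 theta2 y0 : R)
    (y : nat -> T -> R) : Prop :=
  exists c : nat -> {RV P >-> bool},
    [/\ mutually_independent c,
        forall n, P (c n @^-1` [set true]) = (2^-1)%:E,
        forall w, y 0%N w = y0 &
        forall n w, y n.+1 w = y n w + (if c n w then theta1 else theta2)].

(* The realization is (y_1, y_2, ...): the initial value is left out. *)
Definition realization (T : Type) (R : realType) (y : nat -> T -> R) (w : T) :
  nat -> R := fun n => y n.+1 w.

(* Main.v *)
Require Import Defs.
From HB Require Import structures.
From mathcomp Require Import all_boot all_order all_algebra.
From mathcomp Require Import all_classical all_reals all_analysis.
From mathcomp Require Import ring lra zify.
Import Order.TTheory GRing.Theory Num.Theory.
Import numFieldNormedType.Exports.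
Local Open Scope classical_set_scope.
Local Open Scope ring_scope.

(* Call f a coboundary if f = g - Qg for a bounded g, where
   Qg x = (g (x + theta1) + g (x + theta2)) / 2 is the transition operator.
   Along the walk, f (y n) = g (y n) - g (y n.+1) + D_n, where D_n is a fair
   sign times a bounded function of y n. The martingale sum of the D_n has
   fourth moment O(N^2), so by Markov and Borel-Cantelli the averages of f along
   almost every realization tend to 0. Irrationality of theta1 or theta2 makes
   every trigonometric polynomial of mean zero a coboundary, in
   particular each translate of the Fejer kernel, minus its mean 1. The
   translates of the M-th Fejer kernel by the multiples of 1/M sum to M; keeping
   those close to an interval majorizes its indicator up to a small error, which
   bounds the proportion of points in it from above, uniformly in the interval.
   The lower bound follows by applying this to the two complementary intervals. *)

(** * Cosine sums over arithmetic progressions and the Fejer kernel *)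

Section trigonometric_sums.
Context {R : realType}.
Implicit Types (x t h phi theta : R) (M : nat).

(** The factor [2 * sin h] turns each cosine into a difference of sines at angles [2 * h] apart, so
    the sum telescopes. Keeping it as a factor covers [sin h = 0] too. *)
Lemma sum_cos_arith h phi M :
  2 * sin h * (\sum_(j < M) cos (phi + 2 * h * j%:R)) =
  sin (phi + h * (2 * M%:R - 1)) - sin (phi - h).
Proof.
elim: M => [|M IH].
  by rewrite big_ord0 mulr0 mulr0 sub0r mulrN1 subrr.
rewrite big_ord_recr /= mulrDr {}IH.
have -> : phi + h * (2 * M.+1%:R - 1) = (phi + 2 * h * M%:R) + h.
  by rewrite -natr1; ring.
have -> : phi + h * (2 * M%:R - 1) = (phi + 2 * h * M%:R) - h by ring.
rewrite (sinD _ h) (sinB _ h); ring.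
Qed.

Lemma sum_cos_arith_bound h phi M :
  `|sin h * \sum_(j < M) cos (phi + 2 * h * j%:R)| <= 1.
Proof.
have -> : sin h * \sum_(j < M) cos (phi + 2 * h * j%:R) =
    (sin (phi + h * (2 * M%:R - 1)) - sin (phi - h)) / 2.
  by rewrite -sum_cos_arith; field.
move: (sin_le1 (phi + h * (2 * M%:R - 1))) (sin_geN1 (phi + h * (2 * M%:R - 1))).
move: (sin_le1 (phi - h)) (sin_geN1 (phi - h)).
by move=> *; rewrite ler_norml; apply/andP; split; lra.
Qed.

Lemma cosD_2pi_nat x (n : nat) : cos (x + 2 * pi * n%:R) = cos x.
Proof.
rewrite -[RHS](periodicn (@cosD2pi R) n); congr cos.
by rewrite -mulr_natr; ring.
Qed.

Lemma cosD_2pi_int x (m : int) : cos (x + 2 * pi * m%:~R) = cos x.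
Proof.
case: m => n; first exact: cosD_2pi_nat.
rewrite NegzE mulrNz mulrN -[LHS](@cosD_2pi_nat _ n.+1).
by rewrite -pmulrn subrK.
Qed.

Lemma sin_pi_eq0 x : sin (pi * x) = 0 -> exists m : int, x = m%:~R.
Proof.
move=> sx0; exists (Num.floor x); apply/eqP.
have /andP[fx xf] := floor_itv x; rewrite eq_le fx andbT leNgt.
apply/negP => fltx.
set f := x - (Num.floor x)%:~R.
have /sin_gt0_pi : 0 < pi * f < pi.
  rewrite mulr_gt0 ?pi_gt0 ?subr_gt0 //= -[ltRHS]mulr1 ltr_pM2l ?pi_gt0 //.
  by rewrite ltrBlDr -(intrD _ 1 (Num.floor x)) addrC.
(* Removing the integer part of [x] may flip the sign of the sine; doubling the angle makes it a
   shift by full periods. *)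
suff : cos (2 * (pi * f)) = 1.
  move=> c1 sp; have := cos2sin2 (pi * f).
  have := cos_mulr2n (pi * f).
  rewrite (_ : (pi * f) *+ 2 = 2 * (pi * f)) ?c1 => [h1 h2|]; last by ring.
  have : sin (pi * f) ^+ 2 = 0 by move: h1 h2; lra.
  by move/eqP; rewrite sqrf_eq0 gt_eqF.
rewrite -(cosD_2pi_int _ (Num.floor x)).
have -> : 2 * (pi * f) + 2 * pi * (Num.floor x)%:~R = (pi * x) *+ 2.
  by rewrite /f; ring.
rewrite cos_mulr2n cos2sin2 sx0; ring.
Qed.

Lemma cos_2pi_eq1 x : cos (2 * pi * x) = 1 -> exists m : int, x = m%:~R.
Proof.
move=> c1; apply: sin_pi_eq0; apply/eqP; rewrite -sqrf_eq0 sin2cos2.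
move: c1; rewrite (_ : 2 * pi * x = (pi * x) *+ 2); last by ring.
by rewrite cos_mulr2n => c1; apply/eqP; move: c1; lra.
Qed.

Lemma irrational_cos_neq1 theta (r : int) :
  irrational theta -> r != 0 -> cos (2 * pi * (r%:~R * theta)) != 1.
Proof.
move=> irr r0; apply/eqP => /cos_2pi_eq1 [m rm].
apply: irr; exists (m%:~R / r%:~R) => //.
by rewrite rmorphM fmorphV/= !ratr_int -rm mulrAC mulfV ?mul1r // intr_eq0.
Qed.

(** As a double sum the kernel displays its frequencies [j - k]; the diagonal alone gives the mean,
    which is 1 for [M > 0]. *)
Definition fejer M t : R :=
  (\sum_(j < M) \sum_(k < M) cos (2 * pi * ((j%:R - k%:R) * t))) / M%:R.

(** The double sum is the squared modulus of the exponential sum with frequencies below [M];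
    positivity and decay are read off this form. *)
Lemma fejerE M t : fejer M t =
  ((\sum_(j < M) cos (2 * pi * (j%:R * t))) ^+ 2 +
   (\sum_(j < M) sin (2 * pi * (j%:R * t))) ^+ 2) / M%:R.
Proof.
congr (_ / _); rewrite !expr2 !big_distrl/= -big_split; apply: eq_bigr => j _.
rewrite /= !big_distrr -big_split; apply: eq_bigr => k _ /=.
by rewrite -cosB; congr cos; ring.
Qed.

Lemma fejer_ge0 M t : 0 <= fejer M t.
Proof. by rewrite fejerE divr_ge0 ?addr_ge0 ?sqr_ge0. Qed.

Lemma fejerD_int M t (m : int) : fejer M (t + m%:~R) = fejer M t.
Proof.
congr (_ / _); apply: eq_bigr => j _; apply: eq_bigr => k _.
rewrite -[RHS](cosD_2pi_int _ ((j%:Z - k%:Z) * m)); congr cos.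
by rewrite intrM intrB -!pmulrn; ring.
Qed.

Lemma fejer_le M t : (0 < M)%N -> sin (pi * t) != 0 ->
  fejer M t <= 2 / (sin (pi * t) ^+ 2 * M%:R).
Proof.
move=> M0 st; have s2 : 0 < sin (pi * t) ^+ 2 by rewrite exprn_even_gt0.
rewrite fejerE invfM mulrA ler_pM2r ?invr_gt0 ?ltr0n // ler_pdivlMr //.
set C := \sum_(j < M) _; set S := \sum_(j < M) _.
have HC : `|sin (pi * t) * C| <= 1.
  have -> : C = \sum_(j < M) cos (0 + 2 * (pi * t) * j%:R).
    by apply: eq_bigr => j _; congr cos; ring.
  exact: sum_cos_arith_bound.
have HS : `|sin (pi * t) * S| <= 1.
  (* A phase of minus a quarter turn brings the sine sum under the cosine bound. *)
  have -> : S = \sum_(j < M) cos (- (pi / 2) + 2 * (pi * t) * j%:R).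
    by apply: eq_bigr => j _; rewrite addrC cosBpihalf; congr sin; ring.
  exact: sum_cos_arith_bound.
have sq (z : R) : `|z| <= 1 -> z ^+ 2 <= 1.
  by move=> z1; rewrite -real_normK ?num_real // expr_le1.
by move/sq: HC; move/sq: HS; rewrite !exprMn => *; lra.
Qed.

(* Only the frequency [0] survives averaging over the [M]-th roots of unity. *)
Lemma sum_fejer_shift M x : (0 < M)%N ->
  \sum_(l < M) fejer M (x - l%:R / M%:R) = M%:R.
Proof.
move=> M0; have M0' : M%:R != 0 :> R by rewrite pnatr_eq0 -lt0n.
rewrite -mulr_suml exchange_big/=.
under eq_bigr do rewrite exchange_big/=.
have -> : \sum_(j < M) \sum_(k < M) \sum_(l < M)
    cos (2 * pi * ((j%:R - k%:R) * (x - l%:R / M%:R))) =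
    \sum_(j < M) (M%:R : R).
  apply: eq_bigr => j _; rewrite (bigD1 j)//= [X in X + _](_ : _ = M%:R).
    rewrite big1 ?addr0 // => k kj.
    (* Half the step of the angle in [l]. After [M] steps the angle has moved by a multiple of
       [2 * pi], so the telescoped sum vanishes; [sin h] is nonzero because [0 < |j - k| < M]. *)
    pose h : R := - (pi * ((j%:R - k%:R) / M%:R)).
    have sn0 : sin h != 0.
      rewrite sinN oppr_eq0; apply/eqP => /sin_pi_eq0 [m] /(congr1 ( *%R^~ M%:R)).
      rewrite mulfVK //= => jkm.
      have {}jkm : (j%:Z - k%:Z = m * M%:Z)%R.
        by apply: (@intr_inj R); rewrite intrB intrM -!pmulrn.
      move: kj; rewrite -val_eqE /=; move: (ltn_ord j) (ltn_ord k) jkm.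
      move: (nat_of_ord j) (nat_of_ord k) => a b aM bM jkm ba.
      have [m0|m1|m1] : [\/ m = 0, 1 <= m | m <= -1] by 
        case: (ltrgtP m 0) => ?; [constructor 3|constructor 2|constructor 1]; lia.
      - by move: jkm; rewrite m0; lia.
      - nia.
      - nia.
    apply: (@mulfI _ (2 * sin h)).
      by rewrite mulf_neq0 // pnatr_eq0.
    rewrite mulr0.
    under eq_bigr => l _.
      rewrite (_ : 2 * pi * _ = 2 * pi * ((j%:R - k%:R) * x) +
        2 * h * l%:R); last by rewrite /h; ring.
      over.
    rewrite sum_cos_arith; apply/eqP; rewrite subr_eq0; apply/eqP.
    set a := 2 * pi * _.
    rewrite -[LHS]cosBpihalf -[RHS]cosBpihalf -[LHS](cosD_2pi_int _ (j%:Z - k%:Z)).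
    by congr cos; rewrite intrB -!pmulrn /h; field.
  rewrite (eq_bigr (fun=> 1)); last by move=> l _; rewrite subrr mul0r mulr0 cos0.
  by rewrite sumr_const card_ord.
by rewrite sumr_const card_ord -[_ *+ M]mulr_natr mulfK.
Qed.

End trigonometric_sums.

(** * Coboundaries of the transition operator *)

Section coboundary.
Context {R : realType} (theta1 theta2 : R).
Implicit Types (f g : R -> R) (t : R).

Definition coboundary f : Prop := exists g, (exists B, forall x, `|g x| <= B) /\
  forall x, f x = g x - (g (x + theta1) + g (x + theta2)) / 2.

Lemma coboundary0 : coboundary (fun=> 0).
Proof.
exists (fun=> 0); split; first by exists 0 => x; rewrite normr0.
by move=> x; rewrite addr0 mul0r subr0.
Qed.

Lemma coboundaryD f1 f2 : coboundary f1 -> coboundary f2 ->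
  coboundary (fun x => f1 x + f2 x).
Proof.
move=> [g1 [[B1 gB1] f1E]] [g2 [[B2 gB2] f2E]].
exists (fun x => g1 x + g2 x); split.
  by exists (B1 + B2) => x; rewrite (le_trans (ler_normD _ _)) ?lerD.
by move=> x; rewrite f1E f2E; field.
Qed.

Lemma coboundaryZ a f : coboundary f -> coboundary (fun x => a * f x).
Proof.
move=> [g [[B gB] fE]]; exists (fun x => a * g x); split.
  by exists (`|a| * B) => x; rewrite normrM ler_wpM2l.
by move=> x; rewrite fE; field.
Qed.

Lemma coboundary_sum I (r : seq I) (F : I -> R -> R) :
  (forall i, coboundary (F i)) -> coboundary (fun x => \sum_(i <- r) F i x).
Proof.
move=> cF; elim: r => [|i r IH].
  by under eq_fun do rewrite big_nil; exact: coboundary0.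
by under eq_fun do rewrite big_cons; exact: coboundaryD.
Qed.

(** The transition operator preserves the span of the cosine and sine of frequency [r], so solving
    for [g] is a 2 by 2 linear system with determinant [D = (1 - a)^2 + b^2]. It is nonzero since an
    irrational step forces [a < 1]. *)
Lemma coboundary_cos (r : int) t : irrational theta1 \/ irrational theta2 ->
  r != 0 -> coboundary (fun x => cos (2 * pi * (r%:~R * (x - t)))).
Proof.
move=> irr r0.
pose c theta : R := cos (2 * pi * (r%:~R * theta)).
pose s theta : R := sin (2 * pi * (r%:~R * theta)).
pose a := (c theta1 + c theta2) / 2; pose b := (s theta1 + s theta2) / 2.
have a1 : 1 - a != 0.
  have cle x : c x <= 1 by exact: cos_le1.
  have clt : c theta1 < 1 \/ c theta2 < 1.
    by case: irr => /irrational_cos_neq1 /(_ r0) ne; [left|right];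
      rewrite lt_neqAle ne cle.
  apply/eqP; rewrite /a; have := cle theta1; have := cle theta2.
  by case: clt => *; lra.
pose D := (1 - a) ^+ 2 + b ^+ 2.
have D0 : D != 0.
  by rewrite gt_eqF // ltr_pwDl ?sqr_ge0 // exprn_even_gt0.
pose A := (1 - a) / D; pose B := - b / D.
exists (fun x => A * c (x - t) + B * s (x - t)); split.
  exists (`|A| + `|B|) => x; rewrite (le_trans (ler_normD _ _)) // !normrM.
  by rewrite lerD // ler_piMr // ?cos_max ?sin_max.
have cD x y : c (x + y) = c x * c y - s x * s y.
  by rewrite /c /s -cosD; congr cos; ring.
have sD x y : s (x + y) = s x * c y + c x * s y.
  by rewrite /c /s -sinD; congr sin; ring.
move=> x; rewrite -/(c (x - t)) ![_ + _ - t]addrAC.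
move: (x - t) => z; rewrite !cD !sD; set C := c z; set S := s z.
transitivity (((1 - a) * A - b * B) * C + ((1 - a) * B + b * A) * S).
  by rewrite /A /B; move: D0; rewrite /D => D0; field.
by rewrite /a /b; field.
Qed.

(** Subtracting 1 cancels the diagonal of the double sum; every other term has a nonzero integer
    frequency. *)
Lemma coboundary_fejer M t : irrational theta1 \/ irrational theta2 ->
  (0 < M)%N -> coboundary (fun x => fejer M (x - t) - 1).
Proof.
move=> irr M0; have M0' : M%:R != 0 :> R by rewrite pnatr_eq0 -lt0n.
rewrite (_ : (fun x => _) = fun x => M%:R^-1 * \sum_(j < M) \sum_(k < M)
    if j == k then 0 else cos (2 * pi * ((j%:Z - k%:Z)%:~R * (x - t)))).
  apply: coboundaryZ; apply: coboundary_sum => j.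
  apply: coboundary_sum => k; case: (eqVneq j k) => [_|jk].
    exact: coboundary0.
  by apply: coboundary_cos => //; rewrite subr_eq0 eqz_nat.
apply/funext => x; rewrite /fejer mulrC; apply: (mulfI M0').
rewrite mulrBr mulr1 !mulVKf//; apply/eqP; rewrite subr_eq -[X in _ + X%:R]card_ord.
rewrite -sum1_card natr_sum -big_split/=; apply/eqP; apply: eq_bigr => j _.
rewrite (bigD1 j)//= [in RHS](bigD1 j)//= eqxx subrr mul0r mulr0 cos0 add0r addrC.
congr (_ + _); apply: eq_bigr => k kj.
by rewrite eq_sym (negPf kj) intrB -!pmulrn.
Qed.

End coboundary.

(** * Finite coin sequences and moments of the martingale *)

Section bit_strings.
Context {R : realType} (theta1 theta2 y0 : R) (h : R -> R).

(** Expectations over [n] tosses become finite sums over these strings. The newest toss is appended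
    last, so that summing over it conditions on the past. *)
Fixpoint bit_strings (n : nat) : seq (seq bool) :=
  if n is m.+1 then
    [seq rcons s true | s <- bit_strings m] ++
    [seq rcons s false | s <- bit_strings m]
  else [:: [::]].

Lemma mem_bit_strings n (s : seq bool) : (s \in bit_strings n) = (size s == n).
Proof.
elim: n s => [|n IH] s; first by rewrite inE; case: s.
rewrite mem_cat; case/lastP: s => [|s b].
  by apply/negbTE; rewrite negb_or; apply/andP; split;
    apply/negP => /mapP [[|? ?]].
rewrite size_rcons eqSS -IH; apply/orP/idP => [|sn].
  by case=> /mapP [s' s'n] /rcons_inj [-> _].
by case: b; [left|right]; apply/mapP; exists s.
Qed.

Lemma sum_bit_stringsS n (F : seq bool -> R) :
  \sum_(s <- bit_strings n.+1) F s =
  \sum_(s <- bit_strings n) (F (rcons s true) + F (rcons s false)).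
Proof. by rewrite big_cat !big_map big_split. Qed.

Lemma sum1_bit_strings n : \sum_(s <- bit_strings n) (1 : R) = 2 ^+ n.
Proof.
elim: n => [|n IH]; first by rewrite big_seq1 expr0.
by rewrite sum_bit_stringsS exprS -IH big_distrr/=; apply: eq_bigr => s _; ring.
Qed.

(* The position of the walk, paired with the martingale whose increments are
   [h] at the current position, signed by the coin. *)
Definition walk_step (p : R * R) (b : bool) : R * R :=
  (p.1 + (if b then theta1 else theta2), p.2 + (if b then h p.1 else - h p.1)).

Definition walk (s : seq bool) : R * R := foldl walk_step (y0, 0) s.

Lemma walk_rcons s b : walk (rcons s b) = walk_step (walk s) b.
Proof. exact: foldl_rcons. Qed.

Variable B : R.
Hypothesis hB : forall x, `|h x| <= B.

Let hB2 x : h x ^+ 2 <= B ^+ 2.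
Proof. by rewrite -real_normK ?num_real // lerXn2r ?nnegrE // (le_trans _ (hB x)). Qed.

(** Summing over the last toss cancels the cross term: [(m + h)^2 + (m - h)^2 = 2 m^2 + 2 h^2]. *)
Lemma walk_moment2 n :
  \sum_(s <- bit_strings n) (walk s).2 ^+ 2 <= 2 ^+ n * (n%:R * B ^+ 2).
Proof.
elim: n => [|n IH]; first by rewrite big_seq1 /walk /= expr0n mul0r mulr0.
rewrite sum_bit_stringsS.
apply: (@le_trans _ _ (\sum_(s <- bit_strings n)
    (2 * (walk s).2 ^+ 2 + 2 * B ^+ 2 * 1))).
  apply: ler_sum => s _; rewrite !walk_rcons /=.
  by have := hB2 (walk s).1; lra.
rewrite big_split/= -!big_distrr/= sum1_bit_strings (exprS 2 n) -[n.+1%:R]natr1.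
by move: IH; lra.
Qed.

(** The odd terms cancel: [(m + h)^4 + (m - h)^4 = 2 m^4 + 12 m^2 h^2 + 2 h^4]. With the second
    moment bound, the induction closes because [3 n^2 + 6 n + 1 <= 3 (n + 1)^2]. *)
Lemma walk_moment4 n :
  \sum_(s <- bit_strings n) (walk s).2 ^+ 4 <= 2 ^+ n * (3 * n%:R ^+ 2 * B ^+ 4).
Proof.
elim: n => [|n IH]; first by rewrite big_seq1 /walk /= !expr0n !(mul0r, mulr0).
rewrite sum_bit_stringsS.
apply: (@le_trans _ _ (\sum_(s <- bit_strings n)
    (2 * (walk s).2 ^+ 4 + 12 * B ^+ 2 * (walk s).2 ^+ 2 + 2 * B ^+ 4 * 1))).
  apply: ler_sum => s _; rewrite !walk_rcons /=.
  have h2 := hB2 (walk s).1.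
  have h4 : h (walk s).1 ^+ 4 <= B ^+ 4.
    by rewrite !(exprM _ 2 2) lerXn2r ?nnegrE ?sqr_ge0.
  have : (walk s).2 ^+ 2 * h (walk s).1 ^+ 2 <= (walk s).2 ^+ 2 * B ^+ 2.
    by rewrite ler_wpM2l ?sqr_ge0.
  by move: h4; lra.
rewrite !big_split/= -!big_distrr/= sum1_bit_strings (exprS 2 n) -[n.+1%:R]natr1.
have m2 : B ^+ 2 * (\sum_(s <- bit_strings n) (walk s).2 ^+ 2) <=
    B ^+ 2 * (2 ^+ n * (n%:R * B ^+ 2)).
  by rewrite ler_wpM2l ?sqr_ge0 // walk_moment2.
have : 0 <= 2 ^+ n * B ^+ 4 by apply: mulr_ge0; [exact: exprn_ge0|exact: exprn_even_ge0].
by move: IH m2; lra.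
Qed.

(** Markov's inequality for the fourth power: the bound is of order [1 / N^2], hence summable,
    whereas second moments would only give [1 / N]. *)
Lemma walk_tail n (e : R) : 0 < e ->
  \sum_(s <- bit_strings n.+1) (e * n.+1%:R <= `|(walk s).2|)%R%:R / 2 ^+ n.+1 <=
  3 * B ^+ 4 / e ^+ 4 / n.+1%:R ^+ 2.
Proof.
move=> e0; set N : R := n.+1%:R; have N0 : 0 < N by rewrite ltr0n.
have p0 : 0 < 2 ^+ n.+1 :> R by rewrite exprn_gt0.
rewrite -mulr_suml ler_pdivrMr //.
suff : \sum_(s <- bit_strings n.+1) (e * N <= `|(walk s).2|)%R%:R * (e * N) ^+ 4
    <= 2 ^+ n.+1 * (3 * N ^+ 2 * B ^+ 4).
  rewrite -mulr_suml -ler_pdivlMr; last by rewrite exprn_gt0 // mulr_gt0.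
  move=> /le_trans; apply; rewrite le_eqVlt; apply/orP; left; apply/eqP.
  by field; rewrite !gt_eqF.
apply: le_trans (walk_moment4 n.+1); apply: ler_sum => s _.
case: (leP (e * N)) => [le|_]; last by rewrite mul0r exprn_even_ge0.
rewrite mul1r.
rewrite -[leRHS]ger0_norm ?exprn_even_ge0 // normrX.
by rewrite lerXn2r ?nnegrE // mulr_ge0 // ltW.
Qed.

End bit_strings.

(** * Borel-Cantelli for events of quadratically decaying probability *)

Lemma sum_inv_squares_le (R : realType) n :
  \sum_(0 <= k < n) (k.+1%:R ^+ 2)^-1 <= 2 - 2 / n.+1%:R :> R.
Proof.
elim: n => [|n IH]; first by rewrite big_geq // divr1 subrr.
rewrite big_nat_recr //= (le_trans (lerD IH (lexx _))) //.
rewrite -[n.+2%:R]natr1; set N : R := n.+1%:R.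
have N1 : 1 <= N by rewrite ler1n.
(* For [N >= 1], [1 / N^2 <= 2 / N - 2 / (N + 1)], which telescopes. *)
rewrite -subr_ge0.
have -> : 2 - 2 / (N + 1) - (2 - 2 / N + (N ^+ 2)^-1) =
    (N - 1) / (N ^+ 2 * (N + 1)).
  by field; rewrite !gt_eqF //; lra.
by rewrite divr_ge0 ?mulr_ge0 ?sqr_ge0 //; lra.
Qed.

Lemma ae_near_notin (d : measure_display) (T : measurableType d) (R : realType)
    (P : probability T R) (F : nat -> set T) (K : R) :
  (forall n, measurable (F n)) ->
  (forall n, (P (F n) <= (K / n.+1%:R ^+ 2)%:E)%E) ->
  \forall w \ae P, \forall n \near \oo, ~ F n w.
Proof.
move=> mF PF.
(* The sign of [K] comes from the bound on the event of index 0. *)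
have K0 : 0 <= K.
  have := le_trans (measure_ge0 P (F 0%N)) (PF 0%N).
  by rewrite lee_fin expr1n divr1.
have P0 : P (lim_sup_set F) = 0%E.
  apply: lim_sup_set_cvg0 => //.
  apply: (@le_lt_trans _ _ (K * 2)%:E); last exact: ltry.
  apply: lime_le; first exact: is_cvg_nneseries.
  apply: nearW => n.
  apply: (@le_trans _ _ (\sum_(0 <= k < n) (K / k.+1%:R ^+ 2)%:E)%E).
    by apply: lee_sum => k _; exact: PF.
  rewrite sumEFin lee_fin -mulr_sumr ler_wpM2l //.
  by rewrite (le_trans (sum_inv_squares_le R n)) // gerBl divr_ge0.
exists (lim_sup_set F); split => //.
  apply: bigcap_measurable => [|k _]; first by exists 0%N.
  exact: bigcup_measurable.
move=> w /= nev n _; apply: contrapT => nF; apply: nev.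
by exists n => // m /= nm Fm; apply: nF; exists m.
Qed.

(** * The law of the first tosses of the coins *)

Section fair_coins.
Context {d : measure_display} {T : measurableType d} {R : realType}.
Context {P : probability T R} (c : nat -> {RV P >-> bool}).

Let coins n w := mkseq (fun i => c i w) n.

Let cylinderE s : [set w | coins (size s) w = s] =
  \bigcap_(i in [set` iota 0 (size s)]) c i @^-1` [set nth false s i].
Proof.
apply/seteqP; split => [w /= ws i|w ws] /=.
  by rewrite mem_iota add0n => /= si; rewrite -[in RHS]ws nth_mkseq.
apply: (@eq_from_nth _ false); rewrite size_mkseq // => i si.
by rewrite nth_mkseq // (ws i) //= mem_iota.
Qed.

Lemma measurable_cylinder s : measurable [set w | coins (size s) w = s].
Proof.
rewrite cylinderE; apply: fin_bigcap_measurable => // i _.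
exact: measurable_funPTI.
Qed.

Lemma measurable_coins n (A : pred (seq bool)) :
  measurable [set w | A (coins n w)].
Proof.
rewrite (_ : [set w | _] = \big[setU/set0]_(s <- bit_strings n | A s)
    [set w | coins n w = s]).
  rewrite big_seq_cond; apply: bigsetU_measurable => s.
  by rewrite mem_bit_strings => /andP[/eqP <- _]; exact: measurable_cylinder.
rewrite -big_filter -bigcup_seq; apply/seteqP; split => [w /= Aw|w].
  by exists (coins n w); rewrite //= mem_filter Aw mem_bit_strings size_mkseq /=.
by case=> s /=; rewrite mem_filter => /andP[As _] ->.
Qed.

Hypothesis c_indep : mutually_independent c.
Hypothesis c_fair : forall n, P (c n @^-1` [set true]) = (2^-1)%:E.

Let fair n b : P (c n @^-1` [set b]) = (2^-1)%:E.
Proof.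
case: b => //; rewrite (_ : _ @^-1` _ = ~` (c n @^-1` [set true])).
  rewrite probability_setC; last exact: measurable_funPTI.
  by rewrite c_fair -EFinB; congr EFin; field.
by apply/seteqP; split => w /=; case: (c n w).
Qed.

Lemma prob_cylinder s :
  P [set w | coins (size s) w = s] = (2 ^- size s)%:E.
Proof.
rewrite cylinderE c_indep ?iota_uniq //.
rewrite (eq_bigr (fun=> (2^-1)%:E)) //.
rewrite prodEFin; congr EFin; rewrite big_const_seq count_predT size_iota.
by rewrite -exprVn; elim: (size s) => //= m ->; rewrite exprS.
Qed.

(** The event is a finite union of cylinders, each of probability [2 ^- n]; an upper bound follows
    from subadditivity, adding one string at a time. *)
Lemma prob_coins_le n (A : pred (seq bool)) :
  (P [set w | A (coins n w)] <=
   (\sum_(s <- bit_strings n) (A s)%:R / 2 ^+ n)%:E)%E.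
Proof.
have sub (r : seq (seq bool)) : {subset r <= bit_strings n} ->
  (P [set w | (coins n w \in r) && A (coins n w)] <=
     (\sum_(s <- r) (A s)%:R / 2 ^+ n)%:E)%E.
  elim: r => [_|s r IH rn].
    by rewrite big_nil (_ : [set w | _] = set0) ?measure0 //; apply/seteqP; split.
  rewrite big_cons EFinD.
  have mr : measurable [set w | (coins n w \in r) && A (coins n w)].
    exact: (measurable_coins n (fun s => (s \in r) && A s)).
  have ms : measurable [set w | (coins n w == s) && A s].
    exact: (measurable_coins n (fun s' => (s' == s) && A s)).
  apply: (@le_trans _ _ (P ([set w | (coins n w == s) && A s] `|`
      [set w | (coins n w \in r) && A (coins n w)]))).
    apply: le_measure; rewrite ?inE //.
    - exact: (measurable_coins n (fun s' => (s' \in s :: r) && A s')).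
    - exact: measurableU.
    - move=> w /=; rewrite inE => /andP[/orP[/eqP <-|wr] Aw].
        by left; rewrite eqxx.
      by right; rewrite wr.
  rewrite (le_trans (measureU2 _ _ _)) // leeD //; last first.
    by apply: IH => s' s'r; apply: rn; rewrite inE s'r orbT.
  have /eqP sn : size s == n by rewrite -mem_bit_strings rn ?mem_head.
  case: (A s); last first.
    rewrite mul0r (_ : [set w | _] = set0) ?measure0 //.
    by apply/seteqP; split => // w /=; rewrite andbF.
  rewrite mul1r -[in leRHS]sn -prob_cylinder le_eqVlt; apply/orP; left.
  apply/eqP; congr (P _); apply/seteqP; rewrite sn.
  by split => w /=; rewrite andbT => /eqP.
apply: le_trans (sub _ (fun=> id)); rewrite le_eqVlt; apply/orP; left.
apply/eqP; congr (P _); apply/seteqP; split => w /=.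
  by rewrite mem_bit_strings size_mkseq eqxx.
by case/andP.
Qed.

End fair_coins.

(** * Almost sure averages of a coboundary along the walk *)

Lemma ae_cvg_coboundary_average (d : measure_display) (T : measurableType d)
    (R : realType) (P : probability T R) (theta1 theta2 y0 : R)
    (y : nat -> T -> R) (f : R -> R) :
  is_process P theta1 theta2 y0 y -> coboundary theta1 theta2 f ->
  \forall w \ae P,
    (fun N : nat => (\sum_(n < N) f (realization y w n)) / N%:R) @ \oo --> (0 : R).
Proof.
move=> [c [c_indep c_fair yS0 yS]] [g [[B gB] fE]].
(* The deviation of [g] after one step from its conditional mean is [h] at the current position if
   the coin shows true, and its opposite otherwise. *)
pose h x := (g (x + theta1) - g (x + theta2)) / 2.
have normB x : - B <= g x <= B by rewrite -ler_norml.
have hB x : `|h x| <= B.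
  have /andP[] := normB (x + theta1); have /andP[] := normB (x + theta2).
  by rewrite ler_norml /h => *; apply/andP; split; lra.
pose W n w := walk theta1 theta2 y0 h (mkseq (fun i => c i w) n).
have WS n w : W n.+1 w = walk_step theta1 theta2 h (W n w) (c n w).
  by rewrite /W mkseqS walk_rcons.
have W1 n w : (W n w).1 = y n w.
  by elim: n => [|n IH]; rewrite ?yS0 // WS /= IH yS.
have telescope N w :
    \sum_(n < N) f (y n w) = g y0 - g (y N w) + (W N w).2.
  elim: N => [|N IH]; first by rewrite big_ord0 yS0 subrr add0r.
  rewrite big_ord_recr /= IH WS /= W1 yS fE /h.
  by case: (c N w); field.
(* The realization starts at [y 1], so the telescoped sum is taken up to [N.+1] and its first term
   removed. Two values of [g] and two martingale increments cost at most [4 * B]; the rest is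
   slack. *)
have sum_bound N w : `|\sum_(n < N) f (realization y w n)| <= `|(W N w).2| + 6 * B.
  have -> : \sum_(n < N) f (realization y w n) = g (y 1%N w) - g (y N.+1 w)
      + (W N.+1 w).2 - (W 1%N w).2.
    move: (telescope 1%N w) (telescope N.+1 w); move: (W 1%N w).2 => m1.
    rewrite big_ord1 big_ord_recl /= yS0 => ->.
    by rewrite (eq_bigr (fun n : 'I_N => f (realization y w n))) // => E; lra.
  rewrite !WS /= !W1.
  have /andP[? ?] := normB (y 1%N w); have /andP[? ?] := normB (y N.+1 w).
  have := hB (y N w); have := hB y0; rewrite !ler_norml.
  move=> /andP[? ?] /andP[? ?].
  have := ler_norm (W N w).2; have := ler_norm (- (W N w).2); rewrite normrN.
  by move=> ? ?; apply/andP; case: (c N w); case: (c 0%N w); split; lra.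
(* Thresholds run over the inverses of positive integers, so that countably many almost sure events
   handle every [e]. *)
have small k : \forall w \ae P, \forall n \near \oo,
    ~ (k.+1%:R^-1 * n.+1%:R <= `|(W n.+1 w).2|).
  apply: (@ae_near_notin _ _ _ _ _ (3 * B ^+ 4 / k.+1%:R^-1 ^+ 4)) => n.
    exact: (measurable_coins c n.+1 (fun s =>
      k.+1%:R^-1 * n.+1%:R <= `|(walk theta1 theta2 y0 h s).2|)).
  apply: le_trans; first exact: (prob_coins_le c c_indep c_fair n.+1 (fun s =>
      k.+1%:R^-1 * n.+1%:R <= `|(walk theta1 theta2 y0 h s).2|)).
  by rewrite lee_fin; apply: walk_tail => //; rewrite invr_gt0 ltr0n.
have := ae_foralln small; apply: filterS => w {}small.
apply/cvgr0Pnorm_le => e e0.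
have [k ke] : exists k : nat, 2 / e < k.+1%:R.
  by exists (Num.truncn (2 / e)); exact: truncnS_gt.
have [k' k'e] : exists k : nat, 12 * B / e < k.+1%:R.
  by exists (Num.truncn (12 * B / e)); exact: truncnS_gt.
have [n0 _ n0P] := small k.
(* The successor excludes the empty average. [k] and [k'] give the martingale and the constant
   [6 * B] half of the error each. *)
exists (maxn n0 k').+1 => // -[//|n] /=; rewrite ltnS geq_max => /andP[n0n k'n].
have /negP := n0P _ n0n; rewrite -ltNge => Wn.
have N0 : 0 < n.+1%:R :> R by rewrite ltr0n.
rewrite normrM normfV [X in _ / X]gtr0_norm // ler_pdivrMr //.
apply: (le_trans (sum_bound _ _)).
have h1 : k.+1%:R^-1 * n.+1%:R <= e / 2 * n.+1%:R.
  rewrite ler_pM2r // -[e / 2]invrK lef_pV2 ?posrE ?ltr0n ?invr_gt0 ?divr_gt0 //.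
  by rewrite invf_div ltW.
have h2 : 12 * B <= e * n.+1%:R.
  have := ltW k'e; rewrite ler_pdivrMr // => /le_trans; apply.
  by rewrite mulrC ler_pM2l // ler_nat.
rewrite (le_trans (lerD (ltW (lt_le_trans Wn h1)) (lexx _))) //.
by move: h2; lra.
Qed.

(** * Majorizing the indicator of an interval by Fejer kernels *)

Section fejer_majorant.
Context {R : realType}.
Implicit Types (a b x delta : R) (M : nat).

Lemma count_nat_itv_le M (p q : R) : p <= q ->
  \sum_(l < M) (p <= l%:R <= q)%R%:R <= q - p + 1 :> R.
Proof.
move=> pq.
(* This count ignores the upper end [q]; it is used below a node already known to lie in the
   interval, hence at most [q]. *)
have ub N : \sum_(l < N) (p <= l%:R <= q)%R%:R <= Num.max 0 (N%:R - p) :> R.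
  elim: N => [|N IH]; first by rewrite big_ord0 le_max lexx.
  rewrite big_ord_recr/= (le_trans (lerD IH (lexx _))) // -natr1.
  case: (leP p N%:R) => pN /=; last first.
    by rewrite addr0 ge_max !le_max lexx /=; apply/orP; right; lra.
  rewrite (max_idPr _) ?subr_ge0 // le_max; apply/orP; right.
  by case: (N%:R <= q) => /=; lra.
elim: M => [|M IH]; first by rewrite big_ord0; lra.
rewrite big_ord_recr/=; case: (boolP (p <= M%:R <= q)) => [/andP[pM Mq]|_].
  rewrite (le_trans (lerD (ub M) (lexx _))) //.
  by rewrite (max_idPr _) ?subr_ge0 //= lerD2r lerD2r.
by rewrite addr0.
Qed.

(** The squared sine is even in [t] and symmetric about 1/2, which reduces to [[0, 1/2]], where the
    sine of [pi * t] increases. *)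
Lemma sin_sqr_ge delta (t : R) : 0 < delta -> delta <= `|t| <= 1 - delta ->
  sin (pi * delta) ^+ 2 <= sin (pi * t) ^+ 2.
Proof.
move=> d0 /andP[dt t1].
have -> : sin (pi * t) ^+ 2 = sin (pi * `|t|) ^+ 2.
  by case: (ger0P t) => // _; rewrite mulrN sinN sqrrN.
have pi0 := @pi_gt0 R.
move: (`|t|) dt t1 => {}t dt t1.
wlog t2 : t dt t1 / t <= 1 / 2 => [wl|].
  case: (leP t (1 / 2)) => t2; first exact: wl.
  have -> : sin (pi * t) = sin (pi * (1 - t)).
    by rewrite mulrBr mulr1 sinB sinpi cospi; ring.
  by apply: wl; lra.
have s0 : 0 <= sin (pi * delta).
  by apply: sin_ge0_pi; apply/andP; split; nra.
suff le : sin (pi * delta) <= sin (pi * t).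
  by rewrite lerXn2r ?nnegrE // (le_trans s0).
rewrite leNgt ltr_sin ?in_itv /=; last 2 first.
- by apply/andP; split; nra.
- by apply/andP; split; nra.
by rewrite -leNgt ler_pM2l.
Qed.

(* The nodes near [[a, b]] on the circle; both neighbourhoods of [0 = 1] are
   included whether or not they are needed. *)
Definition near_nodes M delta a b : pred nat := fun l =>
  [|| l%:R <= M%:R * delta, M%:R * (1 - delta) <= l%:R |
      M%:R * (a - delta) <= l%:R <= M%:R * (b + delta)].

(** Three intervals of total length [M * (b - a + 4 * delta)], each with at most one node more than
    its length. *)
Lemma count_near_nodes M delta a b : 0 < delta -> a <= b ->
  \sum_(l < M) (near_nodes M delta a b l)%:R <=
  M%:R * (b - a + 4 * delta) + 3 :> R.
Proof.
move=> d0 ab; have M0 : 0 <= M%:R :> R by [].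
have Md : 0 <= M%:R * delta by rewrite mulr_ge0 // ltW.
have Mab : 0 <= M%:R * (b - a) by rewrite mulr_ge0 // subr_ge0.
have h1 := @count_nat_itv_le M 0 (M%:R * delta) Md.
have e2 : M%:R * (1 - delta) <= M%:R by lra.
have h2 := @count_nat_itv_le M _ _ e2.
have e3 : M%:R * (a - delta) <= M%:R * (b + delta) by lra.
have h3 := @count_nat_itv_le M _ _ e3.
apply: (@le_trans _ _ (\sum_(l < M) ((0 <= l%:R <= M%:R * delta)%R%:R +
   (M%:R * (1 - delta) <= l%:R <= M%:R)%R%:R +
   (M%:R * (a - delta) <= l%:R <= M%:R * (b + delta))%R%:R))).
  apply: ler_sum => l _; rewrite /near_nodes ler0n ler_nat (ltnW (ltn_ord l)) andbT.
  rewrite -!natrD ler_nat.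
  by case: (l%:R <= M%:R * delta); case: (M%:R * (1 - delta) <= l%:R);
    case: (M%:R * (a - delta) <= l%:R <= M%:R * (b + delta)).
by rewrite !big_split/=; move: h1 h2 h3; lra.
Qed.

(** If [x] lies in the interval modulo 1, all translates at [x] sum to [M], and those at far nodes
    are small by the decay of the kernel. Otherwise the right side is nonnegative. *)
Lemma indicator_le_fejer M delta a b x : (0 < M)%N -> 0 < delta < 1 / 2 ->
  0 <= a -> b <= 1 ->
  (a <= fracpart x <= b)%R%:R <=
  (\sum_(l < M | near_nodes M delta a b l) fejer M (x - l%:R / M%:R)) / M%:R +
  2 / (sin (pi * delta) ^+ 2 * M%:R).
Proof.
move=> M0 /andP[d0 d12] a0 b1.
have MR0 : 0 < M%:R :> R by rewrite ltr0n.
have sd : 0 < sin (pi * delta).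
  by apply: sin_gt0_pi; have := @pi_gt0 R => ?; apply/andP; split; nra.
have C0 : 0 <= 2 / (sin (pi * delta) ^+ 2 * M%:R).
  by rewrite divr_ge0 // mulr_ge0 ?sqr_ge0.
case: (boolP (a <= fracpart x <= b)) => [/andP[ax xb]|_]; last first.
  by rewrite addr_ge0 // divr_ge0 // sumr_ge0 // => l _; exact: fejer_ge0.
rewrite -(ler_pM2r MR0) mul1r mulrDl mulfVK ?gt_eqF //.
rewrite -[leLHS](sum_fejer_shift M x M0).
rewrite (bigID (fun l : 'I_M => near_nodes M delta a b l)) /= lerD2l.
apply: (@le_trans _ _ (\sum_(l < M | ~~ near_nodes M delta a b l)
    2 / (sin (pi * delta) ^+ 2 * M%:R))).
  apply: ler_sum => l; rewrite !negb_or -!ltNge => /and3P[l1 l2 l3].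
  have q1 : delta < l%:R / M%:R by rewrite ltr_pdivlMr // mulrC.
  have q2 : l%:R / M%:R < 1 - delta by rewrite ltr_pdivrMr // mulrC.
  have q3 : l%:R / M%:R < a - delta \/ b + delta < l%:R / M%:R.
    move: l3; rewrite negb_and -!ltNge => /orP[l3|l3]; [left|right].
      by rewrite ltr_pdivrMr // mulrC.
    by rewrite ltr_pdivlMr // mulrC.
  set t := fracpart x - l%:R / M%:R.
  have -> : fejer M (x - l%:R / M%:R) = fejer M t.
    by rewrite -(fejerD_int M t (Num.floor x)); congr fejer; rewrite /t /fracpart; ring.
  (* The lower bound uses that the node avoids the enlarged interval, the upper one that it avoids
     the neighbourhoods of 0 and 1. *)
  have dt : delta <= `|t| <= 1 - delta.
    by rewrite /t; case: (ger0P t); rewrite /t => t0; apply/andP;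
      case: q3 => q3; split; lra.
  have s2 := sin_sqr_ge delta t d0 dt.
  have st : 0 < sin (pi * t) ^+ 2 by apply: lt_le_trans s2; rewrite exprn_gt0.
  apply: (le_trans (fejer_le M t M0 _)).
    by move: st; rewrite lt0r sqrf_eq0 => /andP[].
  have sd2 : 0 < sin (pi * delta) ^+ 2 by rewrite exprn_gt0.
  rewrite ler_pM2l // lef_pV2 ?posrE ?(mulr_gt0 sd2) ?(mulr_gt0 st) //.
  by rewrite ler_pM2r.
rewrite big_mkcond /=.
apply: (@le_trans _ _ (\sum_(l < M) (2 / (sin (pi * delta) ^+ 2 * M%:R)))).
  by apply: ler_sum => l _; case: ifP.
by rewrite sumr_const card_ord -[leLHS]mulr_natr.
Qed.

End fejer_majorant.

(** * From Fejer averages to uniform distribution and discrepancy *)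

Section fejer_criterion.
Context {R : realType} (u : nat -> R).

Lemma proportion_mkseq N a b : proportion (mkseq u N) a b =
  (\sum_(n < N) (a <= fracpart (u n) <= b)%R%:R) / N%:R.
Proof.
rewrite /proportion size_mkseq; congr (_ / _).
rewrite -sum1_count big_mkcond /= big_map natr_sum -val_enum_ord big_map.
by rewrite big_enum /=; apply: eq_bigr => n _; case: ifP.
Qed.

Hypothesis u_fejer : forall M l : nat, (0 < M)%N ->
  (fun N : nat => (\sum_(n < N) (fejer M (u n - l%:R / M%:R) - 1)) / N%:R) @ \oo
    --> (0 : R).

Lemma near_proportion_le (e : R) : 0 < e -> \forall N \near \oo,
  forall a b, 0 <= a -> a <= b -> b <= 1 ->
    proportion (mkseq u N) a b <= b - a + e.
Proof.
move=> e0.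
(* Error budget, fixed before [a] and [b]: [4 * delta], [3 / M] and [6 * eta] are each at most
   [e / 4]. *)
pose eta := e / 24; have eta0 : 0 < eta by rewrite divr_gt0.
pose delta := Num.min (e / 16) (1 / 4).
have d0 : 0 < delta by rewrite lt_min; apply/andP; split; lra.
have de : delta <= e / 16 by rewrite ge_min lexx.
have d4 : delta <= 1 / 4 by rewrite ge_min lexx orbT.
have sd : 0 < sin (pi * delta).
  by apply: sin_gt0_pi; have := @pi_gt0 R => ?; apply/andP; split; nra.
have sd2 : 0 < sin (pi * delta) ^+ 2 by rewrite exprn_gt0.
(* The first summand forces [3 / M <= e / 4], the second makes the contribution of far nodes at most
   [eta]. *)
pose M := (Num.truncn (12 / e + 2 / (sin (pi * delta) ^+ 2 * eta))).+1.
have Mbig : 12 / e + 2 / (sin (pi * delta) ^+ 2 * eta) < M%:R.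
  exact: truncnS_gt.
have M1 : 12 / e < M%:R.
  by apply: le_lt_trans Mbig; rewrite lerDl divr_ge0 // mulr_ge0 // ltW.
have M2 : 2 / (sin (pi * delta) ^+ 2 * eta) < M%:R.
  by apply: le_lt_trans Mbig; rewrite lerDr divr_ge0 // ltW.
have M0 : (0 < M)%N by [].
have MR0 : 0 < M%:R :> R by rewrite ltr0n.
have tail : 2 / (sin (pi * delta) ^+ 2 * M%:R) <= eta.
  move: M2; rewrite ltr_pdivrMr ?(mulr_gt0 sd2) // => M2.
  by rewrite ler_pdivrMr ?(mulr_gt0 sd2) //; move: M2; lra.
(* There are finitely many nodes, so one threshold on [N] serves them all. *)
have avg : \forall N \near \oo, forall l : 'I_M,
    (\sum_(n < N) (fejer M (u n - l%:R / M%:R) - 1)) / N%:R <= eta.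
  apply: filter_forall => l.
  have /cvgr0Pnorm_le/(_ _ eta0) := u_fejer M l M0.
  by apply: filterS => N; apply: le_trans; exact: ler_norm.
near=> N => a b a0 ab b1.
have N0 : 0 < N%:R :> R by rewrite ltr0n; near: N; exact: nbhs_infty_gt.
have sum_le (l : 'I_M) :
    \sum_(n < N) fejer M (u n - l%:R / M%:R) <= (1 + eta) * N%:R.
  have : (\sum_(n < N) (fejer M (u n - l%:R / M%:R) - 1)) / N%:R <= eta.
    by move: l; near: N.
  by rewrite ler_pdivrMr // sumrB sumr_const card_ord => *; lra.
rewrite proportion_mkseq ler_pdivrMr //.
pose S := near_nodes M delta a b.
have dlt : 0 < delta < 1 / 2 by apply/andP; split; lra.
apply: (@le_trans _ _ (\sum_(n < N)
    ((\sum_(l < M | S l) fejer M (u n - l%:R / M%:R)) / M%:R + eta))).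
  apply: ler_sum => n _.
  by rewrite (le_trans (indicator_le_fejer M delta a b (u n) M0 dlt a0 b1)) // lerD2l.
rewrite big_split/= -mulr_suml exchange_big/= sumr_const card_ord -[eta *+ N]mulr_natr.
set K : R := \sum_(l < M) (S l)%:R.
have sumK : \sum_(l < M | S l) \sum_(n < N) fejer M (u n - l%:R / M%:R) <=
    K * ((1 + eta) * N%:R).
  rewrite mulr_suml big_mkcond /=; apply: ler_sum => l _.
  by case: ifP => _; rewrite ?mul0r ?mul1r.
have KX : K / M%:R <= b - a + 4 * delta + 3 / M%:R.
  rewrite ler_pdivrMr // mulrDl mulfVK ?gt_eqF // mulrC.
  exact: count_near_nodes.
have eM : 3 / M%:R <= e / 4.
  by rewrite ler_pdivrMr //; move: M1; rewrite ltr_pdivrMr // => *; lra.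
have M3 : 3 / M%:R <= 3 :> R by rewrite ler_pdivrMr // ler_peMr // ler1n.
apply: (@le_trans _ _ (K / M%:R * ((1 + eta) * N%:R) + eta * N%:R)).
  by rewrite lerD2r ler_pdivrMr // mulrAC mulfVK ?gt_eqF.
rewrite mulrA -mulrDl ler_pM2r //.
move: KX; set X := K / M%:R => KX.
(* [X] is at most 5: [b - a] and [4 * delta] are at most 1, and [3 / M] is at most 3. *)
have X5 : X * eta <= 5 * eta by rewrite ler_pM2r //; lra.
by move: X5; rewrite /eta; lra.
Unshelve. all: by end_near.
Qed.

Lemma near_proportion_dist_le (e : R) : 0 < e -> \forall N \near \oo,
  forall a b, 0 <= a -> a <= b -> b <= 1 ->
    `|proportion (mkseq u N) a b - (b - a)| <= e.
Proof.
move=> e0; have e20 : 0 < e / 2 by rewrite divr_gt0.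
near=> N => a b a0 ab b1.
have N0 : 0 < N%:R :> R by rewrite ltr0n; near: N; exact: nbhs_infty_gt.
have ub : forall a b, 0 <= a -> a <= b -> b <= 1 ->
    proportion (mkseq u N) a b <= b - a + e / 2.
  by near: N; exact: near_proportion_le.
(* The three closed intervals share endpoints, so points may be counted twice; only this inequality
   holds, and it yields the lower bound. *)
have cover : 1 <= proportion (mkseq u N) 0 a + proportion (mkseq u N) a b +
    proportion (mkseq u N) b 1.
  rewrite !proportion_mkseq -!mulrDl ler_pdivlMr // mul1r -!big_split /=.
  rewrite -[N in leLHS]card_ord -sum1_card natr_sum; apply: ler_sum => n _.
  rewrite -!natrD ler_nat.
  have -> : 0 <= fracpart (u n) by rewrite subr_ge0 floor_le_tmp.
  have -> : fracpart (u n) <= 1.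
    have /andP[_ /ltW] := floor_itv (u n).
    by rewrite intrD /fracpart lerBlDr addrC.
  case: (leP (fracpart (u n)) a) => //= /ltW ->.
  by case: (leP (fracpart (u n)) b) => //= /ltW ->.
have := ub _ _ a0 ab b1; have := ub 0 a (lexx 0) a0 (le_trans ab b1).
have := ub b 1 (le_trans a0 ab) b1 (lexx 1).
by move=> *; rewrite ler_norml; apply/andP; split; lra.
Unshelve. all: by end_near.
Qed.

Lemma fejer_uniformly_distributed : uniformly_distributed_mod1 u.
Proof.
move=> a b a0 ab b1; apply/cvgrPdist_le => e /near_proportion_dist_le.
by apply: filterS => N /(_ a b a0 ab b1); rewrite distrC.
Qed.

Lemma fejer_cvg_discrepancy :
  (fun N : nat => discrepancy (mkseq u N)) @ \oo --> (0 : R).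
Proof.
apply/cvgr0Pnorm_le => e /near_proportion_dist_le.
apply: filterS => N He; rewrite /discrepancy; set E := [set r | _].
(* The degenerate interval at 0 shows that the set is nonempty and its supremum nonnegative. *)
have E0 : E `|proportion (mkseq u N) 0 0 - (0 - 0)| by exists 0, 0.
have Ee : ubound E e by move=> r [a [b [a0 ab b1 ->]]]; exact: He.
rewrite ger0_norm; first by apply: ge_sup => //; eexists; exact: E0.
by apply: le_trans (ub_le_sup _ E0) => //; exists e.
Qed.

End fejer_criterion.

(** * Almost sure uniform distribution of the realization *)

Theorem theorem4p1 (d : measure_display) (T : measurableType d) (R : realType)
    (P : probability T R) (theta1 theta2 y0 : R) (y : nat -> T -> R)
    (htheta : irrational theta1 \/ irrational theta2)
    (hy : is_process P theta1 theta2 y0 y) :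
  (\forall w \ae P, uniformly_distributed_mod1 (realization y w)) /\
  (\forall w \ae P,
     (fun N : nat => discrepancy (mkseq (realization y w) N)) @ \oo --> (0 : R)).
Proof.
(* The pairs [(M, l)] are countable, so a single null set serves all translates; it does not depend
   on the interval. *)
have ae_fejer : \forall w \ae P, forall M l : nat, (0 < M)%N ->
    (fun N : nat => (\sum_(n < N)
      (fejer M (realization y w n - l%:R / M%:R) - 1)) / N%:R) @ \oo --> (0 : R).
  apply: ae_foralln => M; apply: ae_foralln => l.
  case: (posnP M) => [->|M0]; first exact: aeW.
  have cob := coboundary_fejer theta1 theta2 M (l%:R / M%:R) htheta M0.
  have := ae_cvg_coboundary_average _ _ _ _ _ _ _ _ _ hy cob.
  by apply: filterS => w cw _.
split; apply: filterS ae_fejer => w.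
  exact: fejer_uniformly_distributed.
exact: fejer_cvg_discrepancy.
Qed.
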